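(* Let $\mathcal{S}$ be a finite set of logical relations. If $\mathcal{S}$ is not tight, then every logical relation is faithfully expressible from $\mathcal{S}$.
   Context: A logical relation is a non-empty subset $R\subseteq\{0,1\}^k$ for some $k\ge 1$ ($k$ is its arity). For a finite set $\mathcal{S}$ of logical relations, a CNF$(\mathcal{S})$-formula over variables $x_1,\dots,x_n$ is a finite conjunction of clauses $R(\xi_1,\dots,\xi_k)$ with $R\in\mathcal{S}$ of arity $k$ and each $\xi_j$ a variable or one of the constants $0,1$; a solution is an assignment satisfying every clause. For a formula (or relation) $\varphi$, $G(\varphi)$ is the subgraph of the hypercube induced by its solutions: vertices are the solutions, and two are adjacent iff they differ in exactly one coordinate. A relation is bijunctive if it is the set of solutions of a 2-CNF formula. A relation $R\subseteq\{0,1\}^k$ is componentwise bijunctive if every connected component of $G(R)$ (viewed as a subset of $\{0,1\}^k$) is bijunctive. $R$ is OR-free if the relation $\{01,10,11\}$ cannot be obtained from $R$ by fixing $k-2$ of its coordinates to constants; $R$ is NAND-free if $\{00,01,10\}$ cannot be obtained from $R$ by fixing $k-2$ of its coordinates to constants. A set $\mathcal{S}$ is tight if every relation in $\mathcal{S}$ is componentwise bijunctive, or every relation in $\mathcal{S}$ is OR-free, or every relation in $\mathcal{S}$ is NAND-free. A relation $R$ is faithfully expressible from $\mathcal{S}$ if there is a CNF$(\mathcal{S})$-formula $\varphi(\mathbf{x},\mathbf{y})$ such that: (1) $R=\{\mathbf{a}:\exists\mathbf{y}\,\varphi(\mathbf{a},\mathbf{y})\}$; (2) for every $\mathbf{a}\in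 R$ the graph $G(\varphi(\mathbf{a},\mathbf{y}))$ (the solutions in $\mathbf{y}$ with $\mathbf{x}=\mathbf{a}$ fixed) is connected; (3) for all $\mathbf{a},\mathbf{b}\in R$ at Hamming distance $1$ there is $\mathbf{w}$ with both $(\mathbf{a},\mathbf{w})$ and $(\mathbf{b},\mathbf{w})$ solutions of $\varphi$. *)

(* Defs.v *)
From HB Require Import structures.
From mathcomp Require Import all_boot.

Set Implicit Arguments.
Unset Strict Implicit.
Unset Printing Implicit Defensive.

(* Boolean assignments to a finite set V of variables; {0,1}^k is cube 'I_k. *)
Notation cube V := {ffun V -> bool}.

Definition hdist (V : finType) (a b : cube V) : nat := #|[set v | a v != b v]|.

(* Edge relation of G(A); its vertex set is A, although the ambient type of
   the relation is the whole cube. *)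
Definition cube_graph (V : finType) (A : {set cube V}) : rel (cube V) :=
  [rel a b | [&& a \in A, b \in A & hdist a b == 1]].

Definition graph_connected (V : finType) (A : {set cube V}) : Prop :=
  {in A &, forall a b, connect (cube_graph A) a b}.

Definition component (V : finType) (A : {set cube V}) (a : cube V) :
    {set cube V} :=
  [set b in A | connect (cube_graph A) a b].

Record logrel := LogRel {
  logrel_val : {k : nat & {set cube 'I_k}};
  _ : (0 < tag logrel_val) && (tagged logrel_val != set0)
}.

HB.instance Definition _ := [isSub for logrel_val].
HB.instance Definition _ := [Choice of logrel by <:].

Definition arity (R : logrel) : nat := tag (logrel_val R).

Definition tuples (R : logrel) : {set cube 'I_(arity R)} :=
  tagged (logrel_val R).

(* The literal (v, b) is satisfied by a iff a v = b: it stands for v when b is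
   true and for the negation of v when b is false. *)
Definition lit_sat (V : finType) (a : cube V) (l : V * bool) : bool :=
  a l.1 == l.2.

Definition cnf_sat (V : finType) (psi : seq (seq (V * bool))) (a : cube V) :
    bool :=
  all (has (lit_sat a)) psi.

Definition is_2cnf (V : finType) (psi : seq (seq (V * bool))) : bool :=
  all (fun c => size c <= 2) psi.

Definition bijunctive (V : finType) (A : {set cube V}) : Prop :=
  exists2 psi : seq (seq (V * bool)),
    is_2cnf psi & A = [set a | cnf_sat psi a].

Definition componentwise_bijunctive (R : logrel) : Prop :=
  forall a, a \in tuples R -> bijunctive (component (tuples R) a).

(* c with its coordinates i and j overwritten by p and q. *)
Definition upd2 (k : nat) (c : cube 'I_k) (i j : 'I_k) (p q : bool) :
    cube 'I_k :=
  [ffun l => if l == i then p else if l == j then q else c l].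

(* The binary relation T is obtained from R by fixing all coordinates except
   i < j to the constants given by c; the values of c at i and j are
   irrelevant. Never the case when the arity of R is 1. *)
Definition obtained_by_fixing (T : rel bool) (R : logrel) : Prop :=
  exists (i j : 'I_(arity R)) (c : cube 'I_(arity R)),
    i < j /\ forall p q : bool, (upd2 c i j p q \in tuples R) = T p q.

Definition or_rel : rel bool := fun p q => p || q.
Definition nand_rel : rel bool := fun p q => ~~ (p && q).

Definition or_free (R : logrel) : Prop := ~ obtained_by_fixing or_rel R.
Definition nand_free (R : logrel) : Prop := ~ obtained_by_fixing nand_rel R.

Definition tight (S : seq logrel) : Prop :=
  [\/ {in S, forall R, componentwise_bijunctive R},
      {in S, forall R, or_free R}
    | {in S, forall R, nand_free R}].

Inductive term (V : finType) : Type :=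
  | Var of V
  | Cst of bool.

Definition term_val (V : finType) (s : cube V) (t : term V) : bool :=
  match t with Var v => s v | Cst b => b end.

(* Arguments need not be distinct: a variable may occur several times. *)
Record clause (V : finType) := Clause {
  clause_rel : logrel;
  clause_arg : 'I_(arity clause_rel) -> term V
}.

Definition clause_sat (V : finType) (s : cube V) (c : clause V) : bool :=
  [ffun l => term_val s (clause_arg (c := c) l)] \in tuples (clause_rel c).

Definition formula (V : finType) := seq (clause V).

Definition formula_over (S : seq logrel) (V : finType) (phi : formula V) :
    bool :=
  all (fun c => clause_rel c \in S) phi.

Definition formula_sat (V : finType) (phi : formula V) (s : cube V) : bool :=
  all (clause_sat s) phi.

(* The assignment (a, w) to the variables x (left) and y (right). *)
Definition join (V W : finType) (a : cube V) (w : cube W) : cube (V + W)%type :=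
  [ffun u => match u with inl v => a v | inr v => w v end].

Definition faithfully_expressible (S : seq logrel) (R : logrel) : Prop :=
  exists (m : nat) (phi : formula ('I_(arity R) + 'I_m)%type),
    [/\ formula_over S phi,
        forall a, a \in tuples R <-> exists w, formula_sat phi (join a w),
        forall a, a \in tuples R ->
          graph_connected [set w | formula_sat phi (join a w)]
      & forall a b, a \in tuples R -> b \in tuples R -> hdist a b = 1 ->
          exists w, formula_sat phi (join a w) /\ formula_sat phi (join b w)].

(* Main.v *)
From Stdlib Require Import Classical_Prop.
Require Import Defs.
From mathcomp Require Import all_boot.

(* Faithful expressibility is closed under conjunction, injective renaming of
   variables and faithful projection.  Since S is not tight, fixing coordinates
   yields OR and NAND, hence all 2-clauses, and some R1 in S has a component C
   that is not closed under majority.  If every restriction of R1 by 2-clauses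
   were isometric on its components, a geodesic from a to c inside the 2-CNF
   hull of geodesics a -> b -> c would run through maj(a, b, c); so some
   restriction of R1 has a walk that cannot be shortened to the Hamming distance
   of its end points.  A shortest such walk flips some x, then pairwise distinct
   coordinates p, ..., q, then x again, and it is cut out by 2-clauses.  Projected
   to x, p, q it is a latch: p >= q, and the pair can move only while x = 1 (up
   to negations).  Two latches that may not be open simultaneously give a hollow
   square, i.e. a cycle, and a cycle covered by the complements of three arcs
   expresses a 3-clause.  All clauses, hence all relations, follow. *)

Set Implicit Arguments.
Unset Strict Implicit.
Unset Printing Implicit Defensive.

(** * Walks in the cube *)

(** A walk is stored as its start and the list of coordinates it flips, not as its vertices. The end
    point depends only on the parities of occurrences, so reordering or cancelling flips is a matter
    of counting. *)
Definition flips (V : finType) (u : cube V) (fs : seq V) : cube V :=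
  [ffun v => u v (+) odd (count_mem v fs)].

Fixpoint walk (V : finType) (X : {set cube V}) (u : cube V) (fs : seq V) : bool :=
  (u \in X) && (if fs is v :: g then walk X (flips u [:: v]) g else true).

Definition pull (U V : finType) (f : U -> V) (s : cube V) : cube U :=
  [ffun u => s (f u)].

Section Cube.

Variable V : finType.
Implicit Types (u a b : cube V) (X : {set cube V}) (f g : seq V).

Lemma flips0 u : flips u [::] = u.
Proof. by apply/ffunP=> v; rewrite ffunE addbF. Qed.

Lemma flips_cat u f g : flips u (f ++ g) = flips (flips u f) g.
Proof. by apply/ffunP=> v; rewrite !ffunE count_cat oddD addbA. Qed.

Lemma flips_cons u v g : flips u (v :: g) = flips (flips u [:: v]) g.
Proof. exact: (flips_cat u [:: v]). Qed.

Lemma flips1E u v w : flips u [:: v] w = u w (+) (v == w).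
Proof. by rewrite ffunE /= addn0; case: eqP. Qed.

Lemma flips_uniq u f v : uniq f -> flips u f v = u v (+) (v \in f).
Proof. by move=> Uf; rewrite ffunE count_uniq_mem //; case: (v \in f). Qed.

Lemma hdist1P a b : reflect (exists v, b = flips a [:: v]) (hdist a b == 1).
Proof.
apply: (iffP cards1P) => [[v Hv]|[v ->]]; exists v.
  apply/ffunP=> w; rewrite flips1E.
  have := in_set1 w v; rewrite -Hv inE eq_sym [w == v]eq_sym => <-.
  by case: (a w); case: (b w).
apply/setP=> w; rewrite !inE flips1E [w == v]eq_sym.
by case: (a w); case: (v == w).
Qed.

Lemma walk_cat X u f g : walk X u (f ++ g) = walk X u f && walk X (flips u f) g.
Proof.
elim: f u => [|v f IH] u /=; last by rewrite IH [flips u (v :: f)]flips_cons andbA.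
by rewrite flips0 andbT; case: g => [|w g] /=; rewrite ?andbT ?andbA ?andbb.
Qed.

Lemma walk_end X u f : walk X u f -> flips u f \in X.
Proof. by rewrite -[f]cats0 walk_cat cats0 => /andP[_ /= /andP[]]. Qed.

Lemma walk_start X u f : walk X u f -> u \in X.
Proof. by case: f => [|v f] /= /andP[]. Qed.

Lemma walk_take X u f i : walk X u f -> walk X u (take i f).
Proof. by rewrite -{1}(cat_take_drop i f) walk_cat => /andP[]. Qed.

Lemma walkP X u f : reflect (forall i, flips u (take i f) \in X) (walk X u f).
Proof.
apply: (iffP idP) => [W i|]; first exact/walk_end/walk_take.
elim: f u => [|v f IH] u H /=.
  by have := H 0; rewrite flips0 andbT.
have := H 0; rewrite take0 flips0 => ->.
by apply: IH => i; have := H i.+1; rewrite /= flips_cons.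
Qed.

Lemma connect_walk X a b : a \in X -> connect (cube_graph X) a b ->
  exists2 f, walk X a f & flips a f = b.
Proof.
move=> aX /connectP[p Hp ->] {b}; elim: p a aX Hp => [|c p IH] a aX /=.
  by exists [::]; rewrite ?flips0 /= ?aX.
case/andP=> /and3P[_ cX /hdist1P[v Ec]] Hp.
have [f Wf Ef] := IH c cX Hp; exists (v :: f); first by rewrite /= aX -Ec.
by rewrite flips_cons -Ec.
Qed.

Lemma connect_step X a v : a \in X -> flips a [:: v] \in X ->
  connect (cube_graph X) a (flips a [:: v]).
Proof. by move=> aX bX; apply/connect1/and3P; split=> //; apply/hdist1P; exists v. Qed.

Lemma walk_connect X a f : walk X a f -> connect (cube_graph X) a (flips a f).
Proof.
elim: f a => [|v f IH] a /=; first by rewrite flips0.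
case/andP=> aX W; rewrite flips_cons; apply: connect_trans (IH _ W).
exact/connect_step/walk_start/W.
Qed.

Lemma cube_graph_connect_sym X : connect_sym (cube_graph X).
Proof.
apply: sym_connect_sym => a b /=.
rewrite /cube_graph /= andbCA /hdist; congr [&& _, _ & #|pred_of_set _| == 1].
by apply/setP=> v; rewrite !inE eq_sym.
Qed.

(** Induction on the distance to [r]: every other vertex has a neighbour in [X] one step closer. *)
Lemma graph_connected_star X r :
    (forall s, s \in X -> s != r -> exists2 v, s v != r v & flips s [:: v] \in X) ->
  graph_connected X.
Proof.
move=> H.
have C s : s \in X -> connect (cube_graph X) s r.
  have [n] := ubnP (hdist s r); elim: n s => // n IH s /ltnSE-lt sX.
  have [->|ne] := eqVneq s r; first exact: connect0.
  have [v sv vX] := H s sX ne.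
  apply: connect_trans (connect_step sX vX) (IH _ _ vX).
  apply: leq_trans lt; apply: proper_card; apply/properP; split.
    apply/subsetP=> w; rewrite !inE flips1E; case: (v =P w) => [<- _|_]; last by rewrite addbF.
    exact: sv.
  exists v; rewrite !inE ?sv // flips1E eqxx.
  by move: sv; case: (s v); case: (r v).
move=> a b aX bX; apply: connect_trans (C a aX) _.
by rewrite cube_graph_connect_sym C.
Qed.

End Cube.

Lemma connect_homo (T T' : finType) (e : rel T) (e' : rel T') (h : T -> T') :
  (forall x y, e x y -> e' (h x) (h y)) ->
  forall x y, connect e x y -> connect e' (h x) (h y).
Proof.
move=> H x y /connectP[p Hp ->] {y}; elim: p x Hp => [|z p IH] x //= /andP[xz Hp].
exact: connect_trans (connect1 (H _ _ xz)) (IH _ Hp).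
Qed.

(** * Connectivity of fibred solution sets *)

Section Join.

Variables V W : finType.

Lemma pull_inl_join (a : cube V) (w : cube W) : pull inl (join a w) = a.
Proof. by apply/ffunP=> v; rewrite !ffunE. Qed.

Lemma join_pull (s : cube (V + W)%type) : join (pull inl s) (pull inr s) = s.
Proof. by apply/ffunP=> -[v|v]; rewrite !ffunE. Qed.

Lemma join_flipl (a : cube V) (w : cube W) v :
  join (flips a [:: v]) w = flips (join a w) [:: inl v].
Proof. by apply/ffunP=> -[x|x]; rewrite !(flips1E, ffunE) /= ?addbF // addn0; case: eqP. Qed.

Lemma join_flipr (a : cube V) (w : cube W) v :
  join a (flips w [:: v]) = flips (join a w) [:: inr v].
Proof. by apply/ffunP=> -[x|x]; rewrite !(flips1E, ffunE) /= ?addbF // addn0; case: eqP. Qed.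

(** A walk in the base lifts edge by edge: inside the fibre one moves to a point that exists over
    both ends of the next edge, then crosses that edge. *)
Lemma graph_connected_fibration (F : {set cube (V + W)%type}) (F1 : {set cube V}) :
  graph_connected F1 ->
  (forall a w, join a w \in F -> a \in F1) ->
  (forall a, a \in F1 -> graph_connected [set w | join a w \in F]) ->
  (forall a b, a \in F1 -> b \in F1 -> hdist a b = 1 ->
     exists2 w, join a w \in F & join b w \in F) ->
  graph_connected F.
Proof.
move=> C1 F1P CF L.
have Cfib a w w' : join a w \in F -> join a w' \in F ->
    connect (cube_graph F) (join a w) (join a w').
  move=> Hw Hw'; have aF1 := F1P _ _ Hw.
  have := CF a aF1 w w'; rewrite !inE => /(_ Hw Hw'); apply: connect_homo.
  move=> x y /and3P[]; rewrite !inE => Hx Hy /hdist1P[v Ey]; apply/and3P; split=> //.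
  rewrite Ey.
  by apply/hdist1P; exists (inr v); rewrite join_flipr.
have main a f : walk F1 a f -> forall w w', join a w \in F ->
    join (flips a f) w' \in F -> connect (cube_graph F) (join a w) (join (flips a f) w').
  elim: f a => [|v f IH] a /=; first by rewrite flips0 => _; exact: Cfib.
  case/andP=> aF1 Wf w w' Hw; rewrite flips_cons => Hw'.
  have vF1 := walk_start Wf.
  have [|z za zb] := L a _ aF1 vF1; first by apply/eqP/hdist1P; exists v.
  apply: connect_trans (Cfib a w z Hw za) _.
  apply: connect_trans (IH _ Wf z w' zb Hw').
  by rewrite join_flipl connect_step // -join_flipl.
move=> s t; rewrite -(join_pull s) -(join_pull t) => Hs Ht.
have [f Wf Ef] := connect_walk (F1P _ _ Hs) (C1 _ _ (F1P _ _ Hs) (F1P _ _ Ht)).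
by rewrite -Ef; apply: main => //; rewrite Ef.
Qed.

End Join.

(** * Closure properties of faithful expressibility *)

Definition rename_term (U V : finType) (f : U -> V) (t : term U) : term V :=
  match t with Var u => Var (f u) | Cst b => Cst V b end.

Definition rename_clause (U V : finType) (f : U -> V) (c : clause U) : clause V :=
  Clause (fun l => rename_term f (clause_arg (c := c) l)).

Definition rename (U V : finType) (f : U -> V) (phi : formula U) : formula V :=
  map (rename_clause f) phi.

Lemma rename_sat (U V : finType) (f : U -> V) (phi : formula U) (s : cube V) :
  formula_sat (rename f phi) s = formula_sat phi (pull f s).
Proof.
rewrite /formula_sat all_map; apply: eq_all => c /=; rewrite /clause_sat /=.
set x := finfun _; set y := finfun _; suff -> : x = y by [].
apply/ffunP=> l; rewrite !ffunE.
by case: (clause_arg l) => //= u; rewrite ffunE.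
Qed.

Lemma rename_over (S : seq logrel) (U V : finType) (f : U -> V) (phi : formula U) :
  formula_over S (rename f phi) = formula_over S phi.
Proof. by rewrite /formula_over all_map. Qed.

(** Phrased for solution sets instead of formulas so that projections compose; arbitrary finite
    types of variables allow auxiliary variables to be combined as sums. *)
Definition faithful (V W : finType) (B : {set cube (V + W)%type}) (A : {set cube V}) :=
  [/\ forall a, a \in A <-> exists w, join a w \in B,
      forall a, a \in A -> graph_connected [set w | join a w \in B]
    & forall a b, a \in A -> b \in A -> hdist a b = 1 ->
        exists2 w, join a w \in B & join b w \in B].

Definition expressible (S : seq logrel) (V : finType) (A : {set cube V}) : Prop :=
  exists (W : finType) (phi : formula (V + W)%type),
    formula_over S phi /\ faithful [set s | formula_sat phi s] A.

Lemma pull_flips (U V : finType) (f : U -> V) (s : cube V) (v : V) : injective f ->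
  pull f (flips s [:: v]) = pull f s \/
  exists u, pull f (flips s [:: v]) = flips (pull f s) [:: u].
Proof.
move=> fI; case: (pickP [pred u | f u == v]) => [u /eqP <-|N].
  by right; exists u; apply/ffunP=> x; rewrite ffunE !flips1E ffunE (inj_eq fI).
by left; apply/ffunP=> x; rewrite ffunE flips1E ffunE eq_sym [f x == v]N addbF.
Qed.

Section Closure.

Variable S : seq logrel.

Lemma expressible_models (V : finType) (phi : formula V) :
  formula_over S phi -> expressible S [set s | formula_sat phi s].
Proof.
move=> Sphi; exists void, (rename inl phi); rewrite rename_over; split=> //.
have E (a : cube V) (w : cube void) :
    (join a w \in [set s | formula_sat (rename inl phi) s]) = formula_sat phi a.
  by rewrite inE rename_sat pull_inl_join.
have w0 : cube void by exact: [ffun => false].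
split=> [a|a _ w w' _ _|a b].
- by rewrite inE; split=> [H|[w]]; [exists w0|]; rewrite E.
- by have -> : w = w' by apply/ffunP=> -[]; exact: connect0.
- by rewrite ![_ \in [set s | formula_sat phi s]]inE => Ha Hb _; exists w0; rewrite E.
Qed.

(** Injectivity preserves the third condition: one flip then changes the pulled-back assignment in
    at most one coordinate, whereas identified variables would change together. *)
Lemma expressible_pull (U V : finType) (f : U -> V) (A : {set cube U}) : injective f ->
  expressible S A -> expressible S [set s | pull f s \in A].
Proof.
move=> fI [W [phi [Sphi [H1 H2 H3]]]].
pose r (x : U + W) : V + W := match x with inl u => inl (f u) | inr w => inr w end.
exists W, (rename r phi); rewrite rename_over; split=> //.
have E (a : cube V) (w : cube W) : (join a w \in [set s | formula_sat (rename r phi) s])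
    = (join (pull f a) w \in [set s | formula_sat phi s]).
  by rewrite !inE rename_sat; congr formula_sat; apply/ffunP=> -[x|x]; rewrite !ffunE.
split=> [a|a|a b]; rewrite [a \in _]inE ?[b \in _]inE.
- by split=> [/H1[w Hw]|[w Hw]]; [exists w; rewrite E | apply/H1; exists w; rewrite -E].
- by move=> /H2; congr graph_connected; apply/setP=> w; rewrite [LHS]inE [RHS]inE E.
- move=> Ha Hb /eqP/hdist1P[v Eb].
  have [w Hw Hw'] : exists2 w, join (pull f a) w \in [set s | formula_sat phi s]
                     & join (pull f b) w \in [set s | formula_sat phi s].
    case: (pull_flips a v fI) => [|[u]]; rewrite -Eb => Ep.
      by have /H1[w Hw] := Ha; exists w; rewrite ?Ep.
    by apply: H3 => //; apply/eqP/hdist1P; exists u.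
  by exists w; rewrite E.
Qed.

Lemma hdist_joinr (V W : finType) (a : cube V) (w w' : cube W) :
  hdist w w' = 1 -> hdist (join a w) (join a w') = 1.
Proof.
by move/eqP/hdist1P=> [v ->]; apply/eqP/hdist1P; exists (inr v); rewrite join_flipr.
Qed.

Lemma hdist_joinl (V W : finType) (a b : cube V) (w : cube W) :
  hdist a b = 1 -> hdist (join a w) (join b w) = 1.
Proof.
by move/eqP/hdist1P=> [v ->]; apply/eqP/hdist1P; exists (inl v); rewrite join_flipl.
Qed.

(** The composite fibre over [a] is itself fibred: its base is the connected fibre of [B] over [a],
    and its fibres are those of [phi]. *)
Lemma expressible_proj (V W : finType) (B : {set cube (V + W)%type}) (A : {set cube V}) :
  faithful B A -> expressible S B -> expressible S A.
Proof.
move=> [A1 A2 A3] [X [phi [Sphi [H1 H2 H3]]]].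
pose r (x : (V + W) + X) : V + (W + X) :=
  match x with inl (inl v) => inl v | inl (inr w) => inr (inl w) | inr x => inr (inr x) end.
exists (W + X)%type, (rename r phi); rewrite rename_over; split=> //.
have E (a : cube V) (w : cube W) (x : cube X) :
    (join a (join w x) \in [set s | formula_sat (rename r phi) s])
    = (join (join a w) x \in [set s | formula_sat phi s]).
  rewrite !inE rename_sat; congr (formula_sat phi _).
  by apply/ffunP=> -[[y|y]|y]; rewrite ffunE /= ffunE ?[RHS]ffunE ?ffunE /= ?ffunE.
split=> [a|a aA|a b aA bA ab].
- split=> [/A1[w /H1[x Hx]]|[w]]; first by exists (join w x); rewrite E.
  rewrite -(join_pull w) E => Hw; apply/A1; exists (pull inl w).
  by apply/H1; exists (pull inr w).
- apply: (graph_connected_fibration (A2 a aA)) => [w x|w|w w'].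
  + by rewrite [in X in X -> _]inE E => Hx; rewrite inE; apply/H1; exists x.
  + rewrite inE => /H2; congr graph_connected; apply/setP=> x.
    by rewrite [LHS]inE [RHS]inE [RHS]inE E.
  + rewrite !inE => Hw Hw' ww'.
    have [x Hx Hx'] := H3 _ _ Hw Hw' (hdist_joinr a ww').
    by exists x; rewrite inE E.
- have [w Hw Hw'] := A3 a b aA bA ab.
  have [x Hx Hx'] := H3 _ _ Hw Hw' (hdist_joinl w ab).
  by exists (join w x); rewrite E.
Qed.

(** The auxiliary variables of the two formulas are kept apart, so the fibre over [a] is a product
    of two connected fibres. *)
Lemma expressibleI (V : finType) (A B : {set cube V}) :
  expressible S A -> expressible S B -> expressible S (A :&: B).
Proof.
move=> [W [phi [Sphi [H1 H2 H3]]]] [X [psi [Spsi [K1 K2 K3]]]].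
pose rW (x : V + W) : V + (W + X) := match x with inl v => inl v | inr w => inr (inl w) end.
pose rX (x : V + X) : V + (W + X) := match x with inl v => inl v | inr x => inr (inr x) end.
exists (W + X)%type, (rename rW phi ++ rename rX psi).
split; first by rewrite /formula_over all_cat -!/(formula_over _ _) !rename_over Sphi.
have E (a : cube V) (w : cube W) (x : cube X) :
    (join a (join w x) \in [set s | formula_sat (rename rW phi ++ rename rX psi) s])
    = (join a w \in [set s | formula_sat phi s]) && (join a x \in [set s | formula_sat psi s]).
  rewrite !inE {1}/formula_sat all_cat; congr andb.
    rewrite [LHS]rename_sat; congr (formula_sat phi _).
    by apply/ffunP=> -[y|y]; rewrite ffunE /= !ffunE /= ?ffunE.
  rewrite [LHS]rename_sat; congr (formula_sat psi _).
  by apply/ffunP=> -[y|y]; rewrite ffunE /= !ffunE /= ?ffunE.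
split=> [a|a|a b]; rewrite ?in_setI.
- split=> [/andP[/H1[w Hw] /K1[x Hx]]|[w]].
    by exists (join w x); rewrite E Hw.
  rewrite -(join_pull w) E => /andP[Hw Hx].
  by apply/andP; split; [apply/H1|apply/K1]; eexists; eassumption.
- case/andP=> /H2 Ca /[dup] /K1[x0 Hx0] /K2 Da.
  (* The product is fibred over its first factor; the fixed point [x0] of the second lies over both
     ends of every edge. *)
  apply: (graph_connected_fibration Ca) => [w x|w Hw|w w' Hw Hw' _].
  + by rewrite [X in is_true X -> _]inE E [w \in _]inE => /andP[].
  + suff <- : [set x | join a x \in [set s | formula_sat psi s]]
      = [set x | join w x \in [set x | join a x \in
          [set s | formula_sat (rename rW phi ++ rename rX psi) s]]] by [].
    apply/setP=> x.
    move: Hw; rewrite [w \in _]inE => Hw.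
    by rewrite [LHS]inE [RHS]inE [in RHS]inE E Hw.
  + move: Hw Hw'; rewrite [w \in _]inE [w' \in _]inE => Hw Hw'.
    by exists x0; rewrite inE E ?Hw ?Hw'.
- move=> /andP[aA aB] /andP[bA bB] ab.
  have [w Hw Hw'] := H3 _ _ aA bA ab; have [x Hx Hx'] := K3 _ _ aB bB ab.
  by exists (join w x); rewrite E ?Hw ?Hw'.
Qed.

Lemma expressibleT (V : finType) : expressible S [set: cube V].
Proof.
have := @expressible_models V [::] isT.
by congr expressible; apply/setP=> s; rewrite !inE.
Qed.

Lemma expressible_bigcap (V I : finType) (P : pred I) (F : I -> {set cube V}) :
  (forall i, P i -> expressible S (F i)) -> expressible S (\bigcap_(i | P i) F i).
Proof.
by move=> H; apply: big_ind => //; [exact: expressibleT | exact: expressibleI].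
Qed.

(* A fibre over a single Boolean variable is always connected. *)
Lemma expressible_elim (V : finType) (B : {set cube (V + unit)%type}) (A : {set cube V}) :
  (forall a, (a \in A) = [exists b, join a [ffun => b] \in B]) ->
  (forall a v, a \in A -> flips a [:: v] \in A ->
     exists b, (join a [ffun => b] \in B) && (join (flips a [:: v]) [ffun => b] \in B)) ->
  expressible S B -> expressible S A.
Proof.
move=> H1 H3; apply: expressible_proj.
have E (w : cube unit) : w = [ffun => w tt] by apply/ffunP=> -[]; rewrite ffunE.
split=> [a|a aA|a b aA bA /eqP/hdist1P[v Eb]].
- rewrite H1; split=> [/existsP[b Hb]|[w Hw]]; first by exists [ffun => b].
  by apply/existsP; exists (w tt); rewrite -E.
- move=> w w' Hw Hw'; have [->|/eqP ne] := eqVneq w w'; first exact: connect0.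
  have Ew : w' = flips w [:: tt].
    apply/ffunP=> -[]; rewrite flips1E eqxx addbT.
    have : w tt <> w' tt by move=> e; apply: ne; apply/ffunP=> -[].
    by case: (w tt); case: (w' tt).
  by move: Hw'; rewrite Ew; apply: connect_step.
- rewrite Eb in bA *; have [c /andP[Hc Hc']] := H3 a v aA bA.
  by exists [ffun => c].
Qed.

End Closure.

(** * 2-clauses and 2-CNF hulls *)

Lemma expressible_fixing (S : seq logrel) (T : rel bool) (R : logrel) :
  R \in S -> obtained_by_fixing T R ->
  forall (V : finType) (v w : V), expressible S [set s : cube V | T (s v) (s w)].
Proof.
move=> RS [i [j [c [_ H]]]] V v w.
pose arg (l : 'I_(arity R)) :=
  if l == i then Var v else if l == j then Var w else Cst V (c l).
suff -> : [set s : cube V | T (s v) (s w)] = [set s : cube V | formula_sat [:: Clause arg] s].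
  by apply: expressible_models; rewrite /formula_over /= RS.
apply/setP=> s; rewrite !inE -H /formula_sat /= andbT /clause_sat /=.
set x := upd2 _ _ _ _ _; set y := finfun _; suff -> : x = y by [].
by apply/ffunP=> l; rewrite !ffunE /arg; case: eqP => //; case: eqP.
Qed.

Lemma expressible_tuples (S : seq logrel) (R : logrel) : R \in S -> expressible S (tuples R).
Proof.
move=> RS; pose phi := [:: Clause (fun l : 'I_(arity R) => Var l)].
suff -> : tuples R = [set s | formula_sat phi s].
  by apply: expressible_models; rewrite /formula_over /= RS.
apply/setP=> s; rewrite inE /formula_sat /= andbT /clause_sat /=.
by set x := finfun _; suff -> : x = s by []; apply/ffunP=> l; rewrite ffunE.
Qed.

Definition clause2 (V : finType) (l l' : V * bool) : {set cube V} :=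
  [set s : cube V | lit_sat s l || lit_sat s l'].

Definition hull2 (V : finType) (A : {set cube V}) : {set cube V} :=
  [set s : cube V | [forall v, forall w, exists a in A, (a v == s v) && (a w == s w)]].

Section Hull.

Variable V : finType.
Implicit Types (A : {set cube V}) (s a : cube V).

Lemma hull2P A s :
  reflect (forall v w, exists2 a, a \in A & a v = s v /\ a w = s w) (s \in hull2 A).
Proof.
rewrite inE; apply: (iffP forallP) => H v.
  move=> w; have /forallP/(_ w)/existsP[a /and3P[aA /eqP av /eqP aw]] := H v.
  by exists a.
apply/forallP=> w; have [a aA [av aw]] := H v w.
by apply/existsP; exists a; rewrite aA av aw !eqxx.
Qed.

(** A pair of values that no point of [A] takes at [v] and [w] is ruled out by the 2-clause negating
    it. *)
Lemma hull2_bigcap A : hull2 A = \bigcap_(i | A \subset clause2 i.1 i.2) clause2 i.1 i.2.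
Proof.
apply/setP=> s; apply/hull2P/bigcapP => [H [l l'] /= /subsetP sub|H v w].
  have [a /sub] := H l.1 l'.1.
  by rewrite !inE /lit_sat => Ha [<- <-].
have [/exists_inP[a aA /andP[/eqP av /eqP aw]]|N] :=
  boolP [exists a in A, (a v == s v) && (a w == s w)]; first by exists a.
have := H ((v, ~~ s v), (w, ~~ s w)) => /=; rewrite inE /lit_sat /=.
suff /[swap]/[apply] : A \subset clause2 (v, ~~ s v) (w, ~~ s w).
  by case: (s v); case: (s w).
apply/subsetP=> a aA; rewrite inE /lit_sat /=.
move: N; rewrite negb_exists_in => /forall_inP/(_ a aA).
by case: (a v); case: (a w); case: (s v); case: (s w).
Qed.

Lemma subset_hull2 A : A \subset hull2 A.
Proof. by apply/subsetP=> a aA; apply/hull2P=> v w; exists a. Qed.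

Lemma hull2T : hull2 [set: cube V] = setT.
Proof. by apply/eqP; rewrite -subTset subset_hull2. Qed.

Lemma bijunctive_hull2 A : bijunctive (hull2 A).
Proof.
exists [seq [:: i.1; i.2] | i <- enum [pred i | A \subset clause2 i.1 i.2]].
  by rewrite /is_2cnf all_map; apply/allP.
rewrite hull2_bigcap; apply/setP=> s; rewrite inE /cnf_sat all_map.
apply/bigcapP/allP => H i Hi.
  by rewrite mem_enum in Hi; have := H i Hi; rewrite inE /= orbF.
by have := H i; rewrite mem_enum /= inE Hi /= orbF inE => ->.
Qed.

Definition maj a b c : cube V := [ffun v => if a v == b v then a v else c v].

(** Baker-Pixley argument: a point [s] of the hull is matched on ever larger sets [T] of
    coordinates. Three points of [A] that match [s] on [T] except at three different coordinates
    have a majority that matches [s] on all of [T]. *)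
Lemma majority_closed_hull2 A : A != set0 ->
  (forall a b c, a \in A -> b \in A -> c \in A -> maj a b c \in A) -> hull2 A = A.
Proof.
case/set0Pn=> a0 a0A closed; apply/eqP; rewrite eqEsubset subset_hull2 andbT.
apply/subsetP=> s /hull2P sH.
suff H n : forall T : {set V}, #|T| <= n -> exists2 a, a \in A & {in T, a =1 s}.
  have [a aA aE] := H #|V| setT (max_card _).
  by have -> : s = a by apply/ffunP=> v; rewrite aE.
elim: n => [|n IH] T.
  by rewrite leqn0 cards_eq0 => /eqP->; exists a0 => // v; rewrite inE.
have sub2 v w : T \subset [set v; w] -> exists2 a, a \in A & {in T, a =1 s}.
  move=> /subsetP sub; have [a aA [av aw]] := sH v w; exists a => // x /sub.
  by rewrite !inE => /orP[] /eqP->.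
have [->|[v vT]] := set_0Vmem T; first by exists a0 => // v; rewrite inE.
have [/eqP|[w]] := set_0Vmem (T :\ v).
  by rewrite setD_eq0 => sub _; apply: (sub2 v v); rewrite setUid.
rewrite !inE => /andP[wv wT].
have [/eqP|[x]] := set_0Vmem (T :\: [set v; w]).
  by rewrite setD_eq0 => /sub2.
rewrite !inE negb_or => /andP[/andP[xv xw] xT] Tn.
have drop y : y \in T -> exists2 a, a \in A & {in T :\ y, a =1 s}.
  by move=> yT; apply: IH; rewrite -ltnS; apply: leq_trans Tn; rewrite (cardsD1 y T) yT.
have [a aA aE] := drop v vT; have [b bA bE] := drop w wT; have [c cA cE] := drop x xT.
exists (maj a b c) => [|y yT]; first exact: closed.
have aE' : y != v -> a y = s y by move=> yv; rewrite aE // !inE yv.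
have bE' : y != w -> b y = s y by move=> yw; rewrite bE // !inE yw.
have cE' : y != x -> c y = s y by move=> yx; rewrite cE // !inE yx.
rewrite ffunE; have [yv|yv] := eqVneq y v.
  rewrite bE' ?cE' ?yv // 1?eq_sym //; by case: eqP.
rewrite aE' //; have [yw|yw] := eqVneq y w; last by rewrite bE' ?eqxx.
by case: eqP => // _; rewrite cE' // yw eq_sym.
Qed.

End Hull.

(** * All 2-clauses from OR and NAND *)

Section TwoClauses.

Variable S : seq logrel.
Hypothesis has_or :
  forall (V : finType) (v w : V), expressible S [set s : cube V | or_rel (s v) (s w)].
Hypothesis has_nand :
  forall (V : finType) (v w : V), expressible S [set s : cube V | nand_rel (s v) (s w)].

(** The implication is the resolvent of NAND([v], z) and OR(z, [w]) for a fresh z. If [v] and [w]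
    coincided, z would have to be the negation of [v], and no value would serve both ends of an edge
    flipping [v]. *)
Lemma expressible_imply (V : finType) (v w : V) : v != w ->
  expressible S [set s : cube V | s v ==> s w].
Proof.
move=> vw.
pose B : {set cube (V + unit)%type} :=
  [set s : cube (V + unit)%type | nand_rel (s (inl v)) (s (inr tt))] :&:
  [set s : cube (V + unit)%type | or_rel (s (inr tt)) (s (inl w))].
have EB a b : (join a [ffun => b] \in B) = ~~ (a v && b) && (b || a w).
  by rewrite !inE !ffunE.
apply: (@expressible_elim _ _ B); last exact: expressibleI.
- move=> a; rewrite inE; apply/idP/existsP => [H|[b]].
    by exists (~~ a v); rewrite EB; move: H; case: (a v); case: (a w).
  by rewrite EB; case: (a v); case: (a w); case: b.
(* The fresh variable is 0 as soon as [v] is 1 at one end; [w] is then 1 at both ends, because [v]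
   and [w] cannot change together. *)
- move=> a x; rewrite !inE => H H'; exists (~~ (a v || flips a [:: x] v)).
  rewrite !EB; move: H H'; rewrite !flips1E.
  case: (eqVneq x v) => [->|_]; first by rewrite (negbTE vw); case: (a v); case: (a w).
  by case: (x == w); case: (a v); case: (a w).
Qed.

Lemma expressible_clause2 (V : finType) (l l' : V * bool) : expressible S (clause2 l l').
Proof.
case: l l' => [v b] [w c].
have [<-|bc] := eqVneq b c.
  case: b.
    suff -> : clause2 (v, true) (w, true) = [set s : cube V | or_rel (s v) (s w)] by [].
    by apply/setP=> s; rewrite !inE /lit_sat /= !eqb_id.
  suff -> : clause2 (v, false) (w, false) = [set s : cube V | nand_rel (s v) (s w)] by [].
  by apply/setP=> s; rewrite !inE /lit_sat /nand_rel /=; case: (s v); case: (s w).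
have [<-|vw] := eqVneq v w.
  suff -> : clause2 (v, b) (v, c) = setT by apply: expressibleT.
  by apply/setP=> s; rewrite !inE /lit_sat /=; move: b c bc => [] []; case: (s v).
case: b c bc => [] [] // _.
- suff -> : clause2 (v, true) (w, false) = [set s : cube V | s w ==> s v].
    by apply: expressible_imply; rewrite eq_sym.
  by apply/setP=> s; rewrite !inE /lit_sat /=; case: (s v); case: (s w).
- suff -> : clause2 (v, false) (w, true) = [set s : cube V | s v ==> s w].
    exact: expressible_imply.
  by apply/setP=> s; rewrite !inE /lit_sat /=; case: (s v); case: (s w).
Qed.

Lemma expressible_hull2 (V : finType) (A : {set cube V}) : expressible S (hull2 A).
Proof. by rewrite hull2_bigcap; apply: expressible_bigcap => i _; exact: expressible_clause2. Qed.

End TwoClauses.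

(** * Expanding distances *)

(** A walk without repeated flips is a geodesic of the cube, so this says that distances within
    components of G([X]) are Hamming distances. *)
Definition isometric (V : finType) (X : {set cube V}) : Prop :=
  forall u f, walk X u f -> exists g, [/\ uniq g, walk X u g & flips u g = flips u f].

Section Isometric.

Variable V : finType.
Implicit Types (X : {set cube V}) (u a b c : cube V) (f g : seq V).

Lemma mem_take_find (p : pred V) f v : v \in take (find p f) f -> ~~ p v.
Proof.
case/(nthP v)=> i; rewrite size_take_min leq_min => /andP[lt _] <-.
by rewrite nth_take // (before_find _ lt).
Qed.

Lemma walk_sub X (Y : {set cube V}) u f :
  (forall i, flips u (take i f) \in Y) -> walk X u f -> walk (X :&: Y) u f.
Proof. by move=> HY /walkP HX; apply/walkP=> i; rewrite inE HX HY. Qed.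

(* The 2-clauses satisfied by the intervals [a, b] and [b, c] force a geodesic
   from a to c to pass through the majority of a, b and c. *)
Lemma maj_connect X a b c : (forall A, isometric (X :&: hull2 A)) -> a \in X ->
  connect (cube_graph X) a b -> connect (cube_graph X) b c ->
  connect (cube_graph X) a (maj a b c).
Proof.
move=> iso aX ab bc.
have isoX : isometric X by rewrite -[X]setIT -hull2T; exact: iso.
have [f1 F1 E1] := connect_walk aX ab; have [g1 [U1 W1]] := isoX _ _ F1.
rewrite {}E1 => E1; have bX : b \in X by rewrite -E1 walk_end.
have [f2 F2 E2] := connect_walk bX bc; have [g2 [U2 W2]] := isoX _ _ F2.
rewrite {}E2 => E2 {f1 f2 F1 F2}.
(* The union of the intervals [a, b] and [b, c], which contain the two geodesics. *)
pose A := [set s : cube V | [forall v, (a v == b v) ==> (s v == a v)]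
                         || [forall v, (b v == c v) ==> (s v == b v)]].
have interval d e g i : uniq g -> flips d g = e ->
    [forall v, (d v == e v) ==> (flips d (take i g) v == d v)].
  move=> Ug Eg; apply/forallP=> v; apply/implyP; rewrite -Eg flips_uniq // flips_uniq ?take_uniq //.
  case: (boolP (v \in take i g)) => [/mem_take->|_]; last by rewrite addbF.
  by case: (d v).
have W3 : walk (X :&: hull2 A) a (g1 ++ g2).
  rewrite walk_cat E1; apply/andP; split; apply: walk_sub => // i;
  by apply/(subsetP (subset_hull2 _)); rewrite inE interval ?orbT.
have [g3 [U3 {}W3]] := iso A _ _ W3; rewrite flips_cat E1 E2 => E3.
have Ec v : c v = a v (+) (v \in g3) by rewrite -E3 flips_uniq.
(* [g3] is a geodesic from [a] to [c] inside the hull of [A]. The claim is that it passes through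
   the majority just before its first flip of a coordinate on which [a] and [b] agree. *)
pose k := find (fun v => a v == b v) g3.
suff -> : maj a b c = flips a (take k g3).
  apply: walk_connect; apply/walkP=> i.
  by have /walkP/(_ (minn i k)) := W3; rewrite inE take_min => /andP[].
apply/ffunP=> v; rewrite ffunE flips_uniq ?take_uniq //.
case: eqP => [/eqP av|av].
  by case: (boolP (v \in take k g3)) => [/mem_take_find|_]; rewrite ?av ?addbF.
rewrite Ec; congr (_ (+) _).
have [vk|vk] := boolP (v \in take k g3); first exact: mem_take vk.
(* Otherwise [v] separates [a] from [b] and is flipped only after [j]. Right after the flip of [j]
   the point differs from [b] at both [v] and [j]; but on [a, b] the value at [j] is that of [b],
   and on [b, c] the value at [v] is. *)
apply/negbTE/negP=> v3.
have k3 : k < size g3 by rewrite ltnNge; apply: contra vk => /take_oversize->.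
pose j := nth v g3 k.
have aj : a j = b j.
  by apply/eqP; apply: (@nth_find _ v (fun v => a v == b v)); rewrite has_find.
have jv : j != v by apply/eqP=> jv; apply: av; rewrite -jv.
have Ut : uniq (rcons (take k g3) j) by rewrite -take_nth // take_uniq.
have /walkP/(_ k.+1) := W3; rewrite inE (take_nth v) // -/j => /andP[_ /hull2P/(_ v j)[t]].
rewrite !flips_uniq // !mem_rcons !inE eqxx (negbTE vk) eq_sym (negbTE jv) /= addbT addbF.
move=> /orP[] /forallP tA [tv tj].
  by have := tA j; rewrite aj eqxx /= tj aj; case: (b j).
have := tA v; rewrite tv Ec v3.
by move: av; case: (a v); case: (b v).
Qed.

(** By [maj_connect] the component is closed under majority, hence equal to its 2-CNF hull. *)
Lemma bijunctive_component X a0 : (forall A, isometric (X :&: hull2 A)) -> a0 \in X ->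
  bijunctive (component X a0).
Proof.
move=> iso a0X; have sym := cube_graph_connect_sym X.
rewrite -[component X a0]majority_closed_hull2; first exact: bijunctive_hull2.
  by apply/set0Pn; exists a0; rewrite inE a0X connect0.
move=> a b c; rewrite !inE => /andP[aX a0a] /andP[bX a0b] /andP[cX a0c].
have am : connect (cube_graph X) a (maj a b c).
  apply: maj_connect => //; first by apply: connect_trans a0b; rewrite sym.
  by apply: connect_trans a0c; rewrite sym.
rewrite (connect_trans a0a am) andbT.
by have [f Wf <-] := connect_walk aX am; exact: walk_end.
Qed.

Lemma flips_wrap u y g : flips u (y :: rcons g y) = flips u g.
Proof.
apply/ffunP=> v; rewrite !ffunE /= -cats1 count_cat /= addn0 addnA addnC addnA !oddD.
by rewrite addbb.
Qed.

Lemma size_uniq_flips u f g : uniq g -> flips u g = flips u f -> size g <= size f.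
Proof.
move=> Ug E; apply: uniq_leq_size => // v vg.
have := congr1 (fun s : cube V => s v) E; rewrite /= flips_uniq // vg ffunE.
by case: (boolP (v \in f)) => // /count_memPn->; case: (u v).
Qed.

Lemma walk_wrap X u y g : walk X u (y :: g) -> flips u g \in X -> walk X u (y :: rcons g y).
Proof.
rewrite -rcons_cons -cats1 walk_cat => W gX.
by rewrite W /= (walk_end W) -flips_cat cats1 rcons_cons flips_wrap gX.
Qed.

(* In a shortest walk without a geodesic replacement, both the walk minus its
   first step and the walk minus its last step are geodesics. *)
Lemma detour X : ~ isometric X -> exists u x g,
  [/\ uniq (x :: g), 1 < size g, walk X u (x :: rcons g x)
    & forall k, 0 < k < size g -> flips u (take k g) \notin X].
Proof.
move=> Niso; apply: NNPP => N; apply: Niso => u f.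
(* Assuming that no detour exists, strong induction on the length replaces every walk by a
   geodesic. *)
have [n] := ubnP (size f); elim: n u f => // n IH u f; rewrite ltnS.
case/lastP: f => [|g y]; first by exists [::].
rewrite size_rcons => lt Wf; move: (Wf); rewrite -cats1 walk_cat => /andP[Wg Wy].
have [g' [Ug' Wg' Eg']] := IH _ _ lt Wg.
(* All but the last step may be taken to be a geodesic already, so only the last coordinate [y] can
   be repeated. *)
suff main h : uniq h -> walk X u (rcons h y) -> size h < n ->
    exists k, [/\ uniq k, walk X u k & flips u k = flips u (rcons h y)].
  rewrite flips_cat -Eg' -flips_cat cats1; apply: main => //.
    by rewrite -cats1 walk_cat Wg' Eg'.
  exact: leq_ltn_trans (size_uniq_flips Ug' Eg') lt.
move: h => {g g' lt Wf Wg Wy Ug' Wg' Eg'} g Ug Wf ltg.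
have [yg|yg] := boolP (y \in g); last by exists (rcons g y); rewrite rcons_uniq yg.
case/splitPr: yg Wf Ug ltg => g1 g2.
rewrite rcons_cat rcons_cons => Wf Ug ltg.
have := Wf; rewrite walk_cat => /andP[W1 W2].
(* If the first [y] is not the first step, the part from it onwards is a shorter walk. Its geodesic
   saves both flips of [y], and the induction hypothesis applies to the whole. *)
case: g1 Wf Ug ltg W1 W2 => [|z g1] Wf Ug ltg W1 W2; last first.
  have [|h [Uh Wh Eh]] := IH _ _ _ W2.
    by apply: leq_ltn_trans ltg; rewrite /= size_rcons size_cat /= !addnS !ltnS leq_addl.
  have szh : size h <= size g2.
    by apply: (@size_uniq_flips (flips u (z :: g1))) Uh _; rewrite Eh flips_wrap.
  rewrite flips_cat -Eh -flips_cat; apply: IH; last by rewrite walk_cat W1.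
  by apply: leq_ltn_trans ltg; rewrite !size_cat /= leq_add2l ltnW.
rewrite !cat0s in Wf Ug ltg {W1 W2}.
rewrite cat0s flips_wrap.
have [sz|sz] := leqP (size g2) 1.
  exists g2; split=> //; first by case/andP: Ug.
  have gX : flips u g2 \in X by rewrite -(flips_wrap u y) (@walk_end _ X).
  have uX := walk_start Wf.
  by case: g2 sz gX {Wf Ug ltg} => [|z []] //= _ gX; rewrite uX ?gX.
(* Now the walk is [y], [g2], [y]. Since it is not a detour, some interior point has its copy with
   [y] unflipped in [X]. Returning there splits the walk into two shorter ones, whose geodesics
   together have length at most that of [g2]. *)
have [k [k0 kX]] : exists k, 0 < k < size g2 /\ flips u (take k g2) \in X.
  apply: NNPP => Nk; apply: N; exists u, y, g2; split=> // k k0.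
  by apply/negP=> kX; apply: Nk; exists k.
case/andP: k0 => k0 kg.
have Wk : walk X u (y :: take k g2).
  by have := walk_take k.+1 Wf; rewrite /= -cats1 takel_cat // ltnW.
have [|h1 [Uh1 Wh1 Eh1]] := IH u (y :: rcons (take k g2) y) _ (walk_wrap Wk kX).
  by rewrite /= size_rcons size_takel ?(ltnW kg) //; apply: leq_trans ltg; rewrite ltnS.
have [||h2 [Uh2 Wh2 Eh2]] := IH (flips u (take k g2)) (y :: rcons (drop k g2) y).
- rewrite /= size_rcons size_drop; apply: leq_ltn_trans ltg.
  by rewrite ltnS -subn_gt0 subnA ?(ltnW kg) // subnn.
- have := Wf; rewrite -[in walk _ _ _](cat_take_drop k g2) rcons_cat -cat_cons walk_cat.
  case/andP=> _; rewrite /= kX -flips_cat cats1; congr walk; rewrite -cat1s.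
  by apply/ffunP=> v; rewrite !ffunE -cats1 !count_cat addnC.
have E2 : flips (flips u (take k g2)) (drop k g2) = flips u g2.
  by rewrite -flips_cat cat_take_drop.
rewrite flips_wrap in Eh1; rewrite flips_wrap E2 in Eh2.
rewrite -Eh2 -[in flips _ h2]Eh1 -flips_cat; apply: IH; last by rewrite walk_cat Wh1 Eh1.
apply: leq_ltn_trans ltg; rewrite size_cat.
apply: (@leq_trans (size (take k g2) + size (drop k g2))).
  apply: leq_add; first exact: size_uniq_flips Uh1 Eh1.
  by apply: (@size_uniq_flips (flips u (take k g2))) => //; rewrite Eh2 E2.
by rewrite -size_cat cat_take_drop leqnSn.
Qed.

End Isometric.

(** * Isolating a shortest detour *)

Section Path.

Variables (V : finType) (X : {set cube V}) (u : cube V) (x : V) (g : seq V).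
Hypotheses (Uxg : uniq (x :: g)) (Wg : walk X u (x :: rcons g x))
  (gX : forall k, 0 < k < size g -> flips u (take k g) \notin X).

(** [b] records whether [x] is flipped and [k] how many flips of [g] are done. The detour has [b]
    true for all [k], and [b] false only at its two ends, which is the condition in [path_set]. *)
Definition path_point (b : bool) (k : nat) : cube V :=
  [ffun v => u v (+) (if v == x then b else v \in take k g)].

Definition path_set : {set cube V} :=
  [set s | [exists b : bool, exists k : 'I_(size g).+1,
     [|| b, val k == 0 | val k == size g] && (s == path_point b k)]].

Lemma path_setP s :
  reflect (exists b k, [/\ k <= size g, [|| b, k == 0 | k == size g] & s = path_point b k])
    (s \in path_set).
Proof.
rewrite inE; apply: (iffP existsP) => [[b /existsP[k /andP[bk /eqP->]]]|[b [k [kg bk ->]]]].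
  by exists b, k; rewrite -ltnS.
by exists b; apply/existsP; exists (Ordinal (kg : k < (size g).+1)); rewrite bk eqxx.
Qed.

Lemma path_point_true k : path_point true k = flips u (x :: take k g).
Proof.
have Uk : uniq (x :: take k g).
  by case/andP: Uxg => xg Ug; rewrite /= take_uniq // andbT; apply: contra xg => /mem_take.
by apply/ffunP=> v; rewrite ffunE flips_uniq // inE; case: eqP.
Qed.

Lemma path_point_false k : path_point false k = flips u (take k g).
Proof.
have /andP[xg Ug] := Uxg; apply/ffunP=> v; rewrite ffunE flips_uniq ?take_uniq //.
case: eqP => // ->; case: (boolP (x \in take k g)) => // /mem_take xg'.
by rewrite xg' in xg.
Qed.

(** The 2-clauses valid on the path fix the coordinates outside [x] and [g] and force the flipped
    coordinates of [g] to form a prefix. What remains besides the path are interior points with [x]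
    unflipped, and [gX] excludes them from [X]. *)
Lemma path_setI : X :&: hull2 path_set = path_set.
Proof.
have /andP[xg Ug] := Uxg.
apply/eqP; rewrite eqEsubset; apply/andP; split; last first.
  rewrite subsetI subset_hull2 andbT; apply/subsetP=> _ /path_setP[b [k [kg bk ->]]].
  have /walkP HW := Wg.
  case: b bk => [_|/= /orP[] /eqP->].
  - by rewrite path_point_true; have := HW k.+1; rewrite /= -cats1 takel_cat.
  - by rewrite path_point_false take0; have := HW 0; rewrite take0.
  - rewrite path_point_false take_size -(flips_wrap u x).
    exact: walk_end Wg.
apply/subsetP=> s; rewrite inE => /andP[sX /hull2P sH].
pose k := find (fun v => s v == u v) g; pose b := s x (+) u x.
have Es : s = path_point b k.
  apply/ffunP=> v; rewrite ffunE; case: eqP => [->|/eqP vx].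
    by rewrite /b; case: (s x); case: (u x).
  have [vk|vk] := boolP (v \in take k g).
    by have := mem_take_find vk; case: (s v); case: (u v).
  rewrite addbF; have [vg|vg] := boolP (v \in g); last first.
    have [t /path_setP[c [l [_ _ ->]]] [<- _]] := sH v v.
    rewrite ffunE (negbTE vx); case: (boolP (v \in take l g)) => [/mem_take vg'|].
      by rewrite vg' in vg.
    by rewrite addbF.
  have kg : k < size g by rewrite ltnNge; apply: contra vk => /take_oversize->.
  pose y := nth v g k; have yg : y \in g by exact: mem_nth.
  have yx : y != x by apply: contra xg => /eqP<-.
  have sy : s y = u y.
    by apply/eqP; apply: (@nth_find _ v (fun v => s v == u v)); rewrite has_find.
  (* [y] is the first unflipped coordinate of [g]: a path point that agrees with [s] there has made
     at most [k] flips, so it has not flipped [v] either. *)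
  have [t /path_setP[c [l [_ _ ->]]]] := sH y v.
  rewrite !ffunE (negbTE vx) (negbTE yx) sy => -[ty <-].
  have yl : y \notin take l g by move: ty; case: (u y); case: (y \in take l g).
  have lk : l <= k.
    rewrite leqNgt; apply: contra yl => kl.
    by rewrite /y -(nth_take v kl) mem_nth // size_take_min leq_min kl.
  case: (boolP (v \in take l g)) => [vl|]; last by rewrite addbF.
  by rewrite -(subnKC lk) takeD mem_cat vl in vk.
rewrite Es; apply/path_setP; exists b, k; split=> //; first exact: find_size.
apply: contraLR sX; rewrite !negb_or => /and3P[/negbTE b0 k0 kg].
by rewrite Es b0 path_point_false gX // lt0n k0 ltn_neqAle kg find_size.
Qed.

End Path.

(** * Latches *)

(* The five triples form a path of length 4 whose end points have Hamming
   distance 2: the comparators p >= q can move only while x = 1. *)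
Definition latch (x p q : bool) : bool := (q ==> p) && (x || (p == q)).

Section Latch.

Variable S : seq logrel.
Hypothesis has_clause2 :
  forall (V : finType) (l l' : V * bool), expressible S (clause2 l l').

(** The coordinates strictly between [p] and [q] are projected away. The fibre over a triple of the
    latch is a single point, except over the open triple ([x] and [p] flipped, [q] not), where it is
    the path that flips [mid] one by one. *)
Lemma latch_expressible (U : finType) (X : {set cube U}) (u : cube U) (x p q : U) (mid : seq U) :
  let g := p :: rcons mid q in
  expressible S X -> uniq (x :: g) -> path_set u x g = X ->
  forall (V : finType) (x' p' q' : V), uniq [:: x'; p'; q'] ->
  expressible S [set s : cube V | latch (s x' (+) u x) (s p' (+) u p) (s q' (+) u q)].
Proof.
move=> g EX Uxg XE V x' p' q' UV; have [xg Ug] : x \notin g /\ uniq g by exact/andP.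
have szg : size g = (size mid).+2 by rewrite /= size_rcons.
have /and3P[xp xq xm] : [&& x != p, x != q & x \notin mid].
  by move: xg; rewrite /g inE mem_rcons inE !negb_or.
have /and3P[pq pm qm] : [&& p != q, p \notin mid & q \notin mid].
  move: Ug; rewrite /g cons_uniq mem_rcons inE negb_or rcons_uniq.
  by case/andP=> /andP[-> ->] /andP[-> _].
have /and3P[x'p' x'q' p'q'] : [&& x' != p', x' != q' & p' != q'].
  by move: UV; rewrite /= !inE negb_or andbT -andbA.
pose h (y : U) : V + U := if y == x then inl x' else if y == p then inl p'
  else if y == q then inl q' else inr y.
have hI : injective h.
  move=> y z; rewrite /h.
  have [->|yx] := eqVneq y x; have [->|zx] := eqVneq z x => //;
  have [yp|yp] := eqVneq y p; have [zp|zp] := eqVneq z p; rewrite ?yp ?zp //;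
  have [yq|yq] := eqVneq y q; have [zq|zq] := eqVneq z q; rewrite ?yq ?zq //;
  by case=> // E; move: x'p' x'q' p'q'; rewrite ?E ?eqxx.
have hx : h x = inl x' by rewrite /h eqxx.
have hp : h p = inl p' by rewrite /h eq_sym (negbTE xp) eqxx.
have hq : h q = inl q' by rewrite /h eq_sym (negbTE xq) eq_sym (negbTE pq) eqxx.
(* The auxiliary copies of [x], [p] and [q] are not in the image of [h]; pinning them makes the
   fibres consist of points [rest k] only. *)
pose unit y : {set cube (V + U)%type} := clause2 (inr y, u y) (inr y, u y).
pose B := [set s | pull h s \in X] :&: (unit x :&: (unit p :&: unit q)).
(* The first flip of [g] is the visible [p], whence [k.-1]. Thus [rest 0] equals [rest 1], and the
   last two coincide likewise: these are the common witnesses for edges that flip [p] or [q]. *)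
pose rest k : cube U := [ffun y => u y (+) (y \in take k.-1 mid)].
have nm y k : y \notin mid -> rest k y = u y.
  move=> ym; rewrite ffunE; case: (boolP (y \in _)) => [/mem_take|]; last by rewrite addbF.
  by rewrite (negbTE ym).
have inner_take y k : y != p -> y != q -> k <= size g -> (y \in take k g) = (y \in take k.-1 mid).
  move=> yp yq; case: k => [|k]; first by rewrite !take0.
  rewrite szg ltnS /g take_cons inE (negbTE yp) -cats1 take_cat [k.+1.-1]/=.
  case: ltnP => // mk _; rewrite mem_cat [in RHS]take_oversize //.
  by case: (k - _) => [|?]; rewrite /= ?inE ?(negbTE yq) orbF.
have p_take k : (p \in take k g) = (0 < k).
  by case: k => [|k]; rewrite ?take0 // /g take_cons inE eqxx.
have q_take k : k <= size g -> (q \in take k g) = (k == size g).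
  move=> kg; have [->|ne] := eqVneq k (size g).
    by rewrite take_size /g inE mem_rcons inE eqxx orbT.
  have lt : k < size g by rewrite ltn_neqAle ne.
  apply/negbTE; move: lt; rewrite szg; case: k {kg ne} => [|k]; rewrite !ltnS ?take0 // => km.
  rewrite /g take_cons inE eq_sym (negbTE pq) -cats1 takel_cat //=.
  by apply: contra qm => /mem_take.
have BP (a : cube V) (w : cube U) :
  reflect (exists k, [/\ k <= size g, [|| a x' (+) u x, k == 0 | k == size g],
     a p' (+) u p = (0 < k), a q' (+) u q = (k == size g) & w = rest k]) (join a w \in B).
  have E : (join a w \in B) = [&& pull h (join a w) \in X, w x == u x, w p == u p & w q == u q].
    by rewrite !inE /lit_sat !ffunE /= !orbb.
  rewrite E -XE; apply: (iffP and4P).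
    case=> /path_setP[b [k [kg bk Es]]] /eqP wx /eqP wp /eqP wq.
    have Ev y : join a w (h y) = u y (+) (if y == x then b else y \in take k g).
      by have := congr1 (fun s : cube U => s y) Es; rewrite /= !ffunE.
    have := Ev x; rewrite hx ffunE eqxx => ax.
    have := Ev p; rewrite hp ffunE eq_sym (negbTE xp) p_take => ap.
    have := Ev q; rewrite hq ffunE eq_sym (negbTE xq) q_take // => aq.
    exists k; split=> //.
    + by rewrite ax addbC addbA addbb.
    + by rewrite ap addbC addbA addbb.
    + by rewrite aq addbC addbA addbb.
    + apply/ffunP=> y; have [->|yx] := eqVneq y x; first by rewrite wx nm.
      have [->|yp] := eqVneq y p; first by rewrite wp nm.
      have [->|yq] := eqVneq y q; first by rewrite wq nm.
      have := Ev y; rewrite /h (negbTE yx) (negbTE yp) (negbTE yq) !ffunE => ->.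
      by rewrite inner_take.
  case=> k [kg bk ap aq ->].
  rewrite !nm // !eqxx; split=> //; apply/path_setP; exists (a x' (+) u x), k; split=> //.
  apply/ffunP=> y; rewrite !ffunE.
  have [->|yx] := eqVneq y x; first by rewrite hx addbC -addbA addbb addbF.
  have [->|yp] := eqVneq y p; first by rewrite hp p_take -ap addbC -addbA addbb addbF.
  have [->|yq] := eqVneq y q; first by rewrite hq q_take // -aq addbC -addbA addbb addbF.
  by rewrite /h (negbTE yx) (negbTE yp) (negbTE yq) ffunE inner_take.
have EB : expressible S B.
  by apply: expressibleI; [exact: expressible_pull | do 2?apply: expressibleI; exact: has_clause2].
apply: expressible_proj EB; split.
- move=> a; rewrite inE /latch; split.
    move=> L; exists (rest (if a p' (+) u p then if a q' (+) u q then size g else 1 else 0)).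
    apply/BP; eexists; split; last reflexivity; rewrite szg; move: L;
    by case: (a x' (+) _); case: (a p' (+) _); case: (a q' (+) _); rewrite ?eqxx.
  case=> w /BP[k [kg bk -> -> _]]; apply/andP; split.
    by apply/implyP=> /eqP->; rewrite szg.
  by case/or3P: bk => [->|/eqP->|/eqP->]; rewrite ?szg ?eqxx ?orbT.
- move=> a _.
  have C k : k <= size mid -> a x' (+) u x -> a p' (+) u p -> a q' (+) u q = false ->
      connect (cube_graph [set w | join a w \in B]) (rest 1) (rest k.+1).
    move=> km ax ap aq.
    have inB l : l <= size mid -> rest l.+1 \in [set w | join a w \in B].
      move=> lm; rewrite inE; apply/BP; exists l.+1; rewrite ax ap aq szg; split=> //.
      + by rewrite ltnS ltnW // ltnS.
      + by rewrite eqSS ltn_eqF // ltnS.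
    elim: k km => [|k IH] km; first exact: connect0.
    apply: connect_trans (IH (ltnW km)) _.
    have Er : rest k.+2 = flips (rest k.+1) [:: nth x mid k].
      have Um : uniq mid by move: Ug; rewrite /g cons_uniq rcons_uniq => /and3P[].
      have Uk : uniq (rcons (take k mid) (nth x mid k)) by rewrite -take_nth ?take_uniq.
      apply/ffunP=> y; rewrite flips1E !ffunE /= (take_nth x) // mem_rcons inE.
      rewrite -addbA; congr (_ (+) _); move: Uk; rewrite rcons_uniq eq_sym.
      by case: eqP => [<- /andP[/negbTE->]|_]; rewrite ?addbF.
    rewrite Er; apply: connect_step; first exact/inB/ltnW.
    by rewrite -Er; exact: inB.
  have fib w w' : w \in [set w | join a w \in B] -> w' \in [set w | join a w \in B] ->
      w = w' \/ (exists2 k, k <= size mid & w = rest k.+1) /\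
        (exists2 k, k <= size mid & w' = rest k.+1) /\
        [/\ a x' (+) u x, a p' (+) u p & a q' (+) u q = false].
    rewrite [w \in _]inE [w' \in _]inE => /BP[k [kg bk apk aqk ->]] /BP[l [lg bl apl aql ->]].
    case ap: (a p' (+) u p) in apk apl; last first.
      by left; case: k l {kg bk aqk lg bl aql} apk apl => [|k] [|l].
    case aq: (a q' (+) u q) in aqk aql.
      by left; rewrite (eqP (esym aqk)) (eqP (esym aql)).
    right; case: k kg bk apk aqk => [//|k] kg bk _ aqk.
    case: l lg {bl} apl aql => [//|l] lg _ aql.
    rewrite szg in kg lg aqk aql bk.
    split; [exists k|split; [exists l|split]] => //.
    - by rewrite -2!ltnS ltn_neqAle kg andbT; apply/eqP=> E; rewrite E eqxx in aqk.
    - by rewrite -2!ltnS ltn_neqAle lg andbT; apply/eqP=> E; rewrite E eqxx in aql.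
    - by move: bk; rewrite -aqk orbF orbF.
  move=> w w' Hw Hw'.
  have [->|[[k km ->] [[l lm ->] [ax ap aq]]]] := fib w w' Hw Hw'; first exact: connect0.
  apply: (@connect_trans _ _ (rest 1)); last exact: C.
  by rewrite cube_graph_connect_sym; exact: C.
- move=> a b; rewrite !inE /latch => La Lb /eqP/hdist1P[v Eb].
  have rest01 : rest 1 = rest 0 by apply/ffunP=> y; rewrite !ffunE !take0.
  have restg : rest (size mid).+1 = rest (size g).
    by apply/ffunP=> y; rewrite !ffunE szg /= take_size take_oversize.
  have Ep : b p' = a p' (+) (v == p') by rewrite Eb flips1E.
  have Eq : b q' = a q' (+) (v == q') by rewrite Eb flips1E.
  have Ex : b x' = a x' (+) (v == x') by rewrite Eb flips1E.
  have vpq : ~~ ((v == p') && (v == q')).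
    by apply: contra p'q' => /andP[/eqP<- /eqP<-].
  pose low (c : cube V) := if c p' (+) u p then 1 else 0.
  pose high (c : cube V) := if c q' (+) u q then size g else (size mid).+1.
  (* If [p] is flipped at both ends, the position with all of [mid] flipped serves both. Otherwise
     [q] is unflipped at both ends, since [p] and [q] cannot change together, and the initial
     position serves both. *)
  have [ab|ab] := boolP ((a p' (+) u p) && (b p' (+) u p)).
    exists (rest (size g)); apply/BP.
    + exists (high a); split; rewrite /high ?szg.
      * by case: ifP.
      * case: ifP => aq; first by rewrite eqxx !orbT.
        by move: La ab; rewrite aq; case: (a x' (+) _); case: (a p' (+) _).
      * by case/andP: ab => ->; case: ifP.
      * by case: ifP => _; rewrite ?eqxx // ltn_eqF.
      * by case: ifP => _ //; rewrite restg szg.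
    + exists (high b); split; rewrite /high ?szg.
      * by case: ifP.
      * case: ifP => bq; first by rewrite eqxx !orbT.
        by move: Lb ab; rewrite bq; case: (b x' (+) _); case: (b p' (+) _); rewrite ?andbF.
      * by case/andP: ab => _ ->; case: ifP.
      * by case: ifP => _; rewrite ?eqxx // ltn_eqF.
      * by case: ifP => _ //; rewrite restg szg.
  have [aq bq] : a q' (+) u q = false /\ b q' (+) u q = false.
    move: La Lb ab vpq; rewrite Ep Eq.
    by case: (a p'); case: (a q'); case: (v == p'); case: (v == q');
      case: (u p); case: (u q); rewrite ?andbF ?orbF.
  have low_ok (c : cube V) : c q' (+) u q = false -> (c q' (+) u q ==> c p' (+) u p) &&
      (c x' (+) u x || (c p' (+) u p == c q' (+) u q)) -> join c (rest 0) \in B.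
    move=> cq; rewrite cq /= => cx; apply/BP; exists (low c).
    split; rewrite /low ?szg ?cq //; first by case: ifP.
    * by move: cx; case: (c p' (+) _); case: (c x' (+) _).
    * by case: ifP.
    * by case: ifP.
    * by case: ifP; rewrite ?rest01.
  by exists (rest 0); apply: low_ok.
Qed.

End Latch.

(** * 3-clauses *)

(* The square p >= q, s >= t with its centre p > q, s > t removed. *)
Definition hollow_square (p q s t : bool) : bool :=
  [&& q ==> p, t ==> s & (p == q) || (s == t)].

(* For fixed p, q, s, t the conditions ~~ q, p && ~~ t and s single out three
   arcs of the hollow square that meet pairwise, but have no common point. *)
Definition clause3_gadget (l1 l2 l3 p q s t : bool) : bool :=
  [&& hollow_square p q s t, l1 || ~~ q, l2 || p, l2 || ~~ t & l3 || s].

(** A base point of each nonempty fibre, towards which every other solution can move by one flip, as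
    [gadget_star] checks. In the default case only the pattern with [l2] alone true is relevant. *)
Definition gadget_centre (l1 l2 l3 : bool) : bool * bool * (bool * bool) :=
  match l1, l2, l3 with
  | true, true, true => (false, false, (false, false))
  | false, true, true => (false, false, (true, false))
  | true, false, true => (true, true, (false, false))
  | true, true, false => (true, false, (true, true))
  | false, false, true => (true, false, (false, false))
  | true, false, false => (true, true, (true, false))
  | _, _, _ => (false, false, (true, true))
  end.

Lemma gadget_centreP (l1 l2 l3 : bool) : [|| l1, l2 | l3] ->
  let: (p, q, (s, t)) := gadget_centre l1 l2 l3 in clause3_gadget l1 l2 l3 p q s t.
Proof. by case: l1 l2 l3 => [] [] []. Qed.

Lemma gadget_star (l1 l2 l3 p q s t : bool) : clause3_gadget l1 l2 l3 p q s t ->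
  let: (p0, q0, (s0, t0)) := gadget_centre l1 l2 l3 in
  [|| [&& p == p0, q == q0, s == s0 & t == t0],
      (p != p0) && clause3_gadget l1 l2 l3 (~~ p) q s t,
      (q != q0) && clause3_gadget l1 l2 l3 p (~~ q) s t,
      (s != s0) && clause3_gadget l1 l2 l3 p q (~~ s) t
    | (t != t0) && clause3_gadget l1 l2 l3 p q s (~~ t)].
Proof. by case: l1 l2 l3 p q s t => [] [] [] [] [] [] []. Qed.

(** Literals occur only positively, so a witness for the literals true at both ends of an edge
    serves both ends. *)
Lemma gadget_monotone (l1 l2 l3 m1 m2 m3 p q s t : bool) :
  l1 ==> m1 -> l2 ==> m2 -> l3 ==> m3 ->
  clause3_gadget l1 l2 l3 p q s t -> clause3_gadget m1 m2 m3 p q s t.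
Proof.
by case: l1 m1 l2 m2 l3 m3 p q s t => [] [] [] [] [] [] [] [] [] [].
Qed.

Lemma lit_sat_flips (V : finType) (a : cube V) (v : V) (l : V * bool) :
  lit_sat (flips a [:: v]) l = lit_sat a l (+) (v == l.1).
Proof. by rewrite /lit_sat flips1E; case: (a l.1); case: l.2; case: (v == l.1). Qed.

Section Gadget.

Variables (S : seq logrel) (e0 e1 e2 : bool).
Hypothesis has_clause2 :
  forall (V : finType) (l l' : V * bool), expressible S (clause2 l l').
Hypothesis has_latch : forall (V : finType) (x p q : V), uniq [:: x; p; q] ->
  expressible S [set s : cube V | latch (s x (+) e0) (s p (+) e1) (s q (+) e2)].

(** The sign [e0] is dictated by the detour. A control of the opposite sign is obtained from a fresh
    one that a 2-clause forbids to be 1 together with [z]. *)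
Lemma latch_neg_expressible (V : finType) (z p q : V) : uniq [:: z; p; q] ->
  expressible S [set s : cube V | latch (~~ (s z (+) e0)) (s p (+) e1) (s q (+) e2)].
Proof.
move=> U; have [zp zq pq] : [/\ z != p, z != q & p != q].
  by move: U; rewrite /= !inE negb_or andbT -andbA => /and3P[].
pose B : {set cube (V + unit)%type} :=
  [set s : cube (V + unit)%type |
    latch (s (inr tt) (+) e0) (s (inl p) (+) e1) (s (inl q) (+) e2)] :&:
  clause2 (inr tt, e0) (inl z, e0).
have BE (a : cube V) b : (join a [ffun => b] \in B) =
    latch (b (+) e0) (a p (+) e1) (a q (+) e2) && ~~ ((b (+) e0) && (a z (+) e0)).
  rewrite !inE /lit_sat /= !ffunE; congr (_ && _).
  by case: b; case: (a z); case: e0.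
apply: (@expressible_elim _ _ B).
- move=> a; rewrite inE; apply/idP/existsP => [H|[b]].
    exists (~~ (a z)); rewrite BE; move: H; rewrite /latch.
    by case: (a z); case: (e0); case: (a p (+) _); case: (a q (+) _).
  rewrite BE /latch.
  by case: b; case: (a z); case: (e0); case: (a p (+) _); case: (a q (+) _).
- move=> a v; rewrite !inE => H H'.
  exists (e0 (+) ~~ ((a z (+) e0) || (flips a [:: v] z (+) e0))).
  rewrite !BE; move: H H'; rewrite !flips1E /latch.
  have : ~~ ((v == z) && (v == p)) by apply: contra zp => /andP[/eqP<- /eqP<-].
  have : ~~ ((v == z) && (v == q)) by apply: contra zq => /andP[/eqP<- /eqP<-].
  by case: (v == z) (v == p) (v == q) (a z) (a p) (a q) (e0) (e1) (e2) =>
    [] [] [] [] [] [] [] [] [].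
- apply: expressibleI => //; apply: has_latch.
  by rewrite /= !inE (inj_eq inl_inj) pq.
Qed.

(** Two latches with opposite controls: at most one of the two pairs can be strict. *)
Lemma hollow_square_expressible (V : finType) (p q s t : V) : uniq [:: p; q; s; t] ->
  expressible S [set a : cube V |
    hollow_square (a p (+) e1) (a q (+) e2) (a s (+) e1) (a t (+) e2)].
Proof.
move=> U; have [[pq ps pt] [qs qt st]] :
    [/\ p != q, p != s & p != t] /\ [/\ q != s, q != t & s != t].
  by move: U; rewrite /= !inE !negb_or andbT -!andbA => /and5P[-> -> -> -> /andP[-> ->]].
pose B : {set cube (V + unit)%type} :=
  [set a : cube (V + unit)%type |
    latch (~~ (a (inr tt) (+) e0)) (a (inl p) (+) e1) (a (inl q) (+) e2)] :&:
  [set a : cube (V + unit)%type |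
    latch (a (inr tt) (+) e0) (a (inl s) (+) e1) (a (inl t) (+) e2)].
have BE (a : cube V) b : (join a [ffun => b] \in B) =
    latch (~~ (b (+) e0)) (a p (+) e1) (a q (+) e2) &&
    latch (b (+) e0) (a s (+) e1) (a t (+) e2).
  by rewrite !inE /= !ffunE.
apply: (@expressible_elim _ _ B).
- move=> a; rewrite inE; apply/idP/existsP => [H|[b]].
    exists (e0 (+) ((a p (+) e1) == (a q (+) e2))); rewrite BE; move: H.
    rewrite /latch /hollow_square.
    by case: (e0); case: (a p (+) _); case: (a q (+) _); case: (a s (+) _); case: (a t (+) _).
  rewrite BE /latch /hollow_square.
  by case: b; case: (e0); case: (a p (+) _); case: (a q (+) _);
    case: (a s (+) _); case: (a t (+) _).
- move=> a v; rewrite !inE => H H'; set a' := flips a [:: v] in H' *.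
  (* The second latch is opened only if the first pair is equal at both ends. Otherwise the second
     pair is equal at both ends, because one flip affects only one pair. *)
  exists (e0 (+) ((a p (+) e1 == a q (+) e2) && (a' p (+) e1 == a' q (+) e2))).
  have vpq : ~~ (((v == p) || (v == q)) && ((v == s) || (v == t))).
    rewrite negb_and !negb_or; case: (eqVneq v p) => [->|_]; rewrite ?ps ?pt //=.
    by case: (eqVneq v q) => [->|_]; rewrite ?qs ?qt.
  have {}vpq : (a' p = a p /\ a' q = a q) \/ (a' s = a s /\ a' t = a t).
    move: vpq; rewrite /a' !flips1E.
    by case: (v == p) (v == q) (v == s) (v == t) => [] [] [] [] //= _; rewrite !addbF; tauto.
  rewrite !BE; move: H H'; rewrite /latch /hollow_square.
  case: vpq => [[-> ->]|[-> ->]].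
    by case: (a p (+) _); case: (a q (+) _); case: (a s (+) _); case: (a t (+) _);
      case: (a' s (+) _); case: (a' t (+) _); case: (e0).
  by case: (a p (+) _); case: (a q (+) _); case: (a s (+) _); case: (a t (+) _);
      case: (a' p (+) _); case: (a' q (+) _); case: (e0).
- apply: expressibleI; [apply: latch_neg_expressible|apply: has_latch];
  by rewrite /= !inE (inj_eq inl_inj) ?pq ?st.
Qed.

(** Each false literal confines the hollow square to one of the three arcs, so the fibre is empty
    exactly when all three literals are false. *)
Lemma clause3_expressible (V : finType) (l1 l2 l3 : V * bool) : uniq [:: l1.1; l2.1; l3.1] ->
  expressible S [set a | [|| lit_sat a l1, lit_sat a l2 | lit_sat a l3]].
Proof.
move=> U.
have [v12 v13 v23] : [/\ l1.1 != l2.1, l1.1 != l3.1 & l2.1 != l3.1].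
  by move: U; rewrite /= !inE negb_or andbT -andbA => /and3P[].
pose W := (bool * bool)%type.
pose p : V + W := inr (false, false); pose q : V + W := inr (false, true).
pose s : V + W := inr (true, false); pose t : V + W := inr (true, true).
pose inl_lit (l : V * bool) : (V + W) * bool := (inl l.1, l.2).
pose B : {set cube (V + W)%type} :=
  [set a : cube (V + W)%type | hollow_square (a p (+) e1) (a q (+) e2) (a s (+) e1) (a t (+) e2)]
  :&: (clause2 (inl_lit l1) (q, e2) :&: (clause2 (inl_lit l2) (p, ~~ e1)
  :&: (clause2 (inl_lit l2) (t, e2) :&: clause2 (inl_lit l3) (s, ~~ e1)))).
have BE (a : cube V) (w : cube W) : (join a w \in B) =
    clause3_gadget (lit_sat a l1) (lit_sat a l2) (lit_sat a l3)
      (w (false, false) (+) e1) (w (false, true) (+) e2)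
      (w (true, false) (+) e1) (w (true, true) (+) e2).
  rewrite !inE /lit_sat /= !ffunE /clause3_gadget.
  rewrite /p /q /s /t /=; do 4?[congr (_ && _)]; congr (_ || _);
  by case: (w _); case: (e1); case: (e2).
pose r (l1 l2 l3 : bool) : cube W :=
  let: (p, q, (s, t)) := gadget_centre l1 l2 l3 in
  [ffun ij : W => match ij with
    | (false, false) => p (+) e1 | (false, true) => q (+) e2
    | (true, false) => s (+) e1 | (true, true) => t (+) e2 end].
have rP (a : cube V) k1 k2 k3 : [|| k1, k2 | k3] ->
    k1 ==> lit_sat a l1 -> k2 ==> lit_sat a l2 -> k3 ==> lit_sat a l3 ->
    join a (r k1 k2 k3) \in B.
  move=> /gadget_centreP; rewrite BE /r.
  case: (gadget_centre _ _ _) => [[p0 q0] [s0 t0]] H i1 i2 i3.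
  apply: gadget_monotone i1 i2 i3 _.
  by rewrite !ffunE -!addbA !addbb !addbF.
have EB : expressible S B.
  do 4?[apply: expressibleI => //]; exact: hollow_square_expressible.
apply: expressible_proj EB; split.
- move=> a; rewrite inE; split=> [H|[w]].
    by exists (r (lit_sat a l1) (lit_sat a l2) (lit_sat a l3)); apply: rP; rewrite ?implybb.
  rewrite BE; case: (lit_sat a l1); case: (lit_sat a l2); case: (lit_sat a l3) => //.
  by case: (w (false, false) (+) _); case: (w (false, true) (+) _);
    case: (w (true, false) (+) _); case: (w (true, true) (+) _).
- move=> a _.
  apply: (@graph_connected_star _ _ (r (lit_sat a l1) (lit_sat a l2) (lit_sat a l3))).
  move=> w; rewrite inE BE => /gadget_star; rewrite /r.
  case: (gadget_centre _ _ _) => [[p0 q0] [s0 t0]].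
  have xorN b c : (b (+) c == ~~ b) = c by case: b c => [] [].
  have ne b c e : (b (+) e != c) = (b != c (+) e) by case: b c e => [] [] [].
  case/or4P=> [/and4P[/eqP E1 /eqP E2 /eqP E3 /eqP E4]|/andP[H1 H2]|/andP[H1 H2]|].
  + case/eqP; apply/ffunP=> -[i j]; rewrite ffunE -E1 -E2 -E3 -E4.
    by case: i; case: j; rewrite -addbA addbb addbF.
  + by exists (false, false); rewrite ?ffunE -?ne // inE BE !flips1E /= !addbF addbT addNb.
  + by exists (false, true); rewrite ?ffunE -?ne // inE BE !flips1E /= !addbF addbT addNb.
  + case/orP=> /andP[H1 H2].
      by exists (true, false); rewrite ?ffunE -?ne // inE BE !flips1E /= !addbF addbT addNb.
    by exists (true, true); rewrite ?ffunE -?ne // inE BE !flips1E /= !addbF addbT addNb.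
- move=> a b; rewrite !inE => La Lb /eqP/hdist1P[v Eb].
  pose k l := lit_sat a l && lit_sat b l.
  (* With distinct variables a flip changes at most one literal, so some literal is true at both
     ends. *)
  have K : [|| k l1, k l2 | k l3].
    have n12 : ~~ ((v == l1.1) && (v == l2.1)) by apply: contra v12 => /andP[/eqP<- /eqP<-].
    have n13 : ~~ ((v == l1.1) && (v == l3.1)) by apply: contra v13 => /andP[/eqP<- /eqP<-].
    have n23 : ~~ ((v == l2.1) && (v == l3.1)) by apply: contra v23 => /andP[/eqP<- /eqP<-].
    move: La Lb n12 n13 n23; rewrite /k Eb !lit_sat_flips.
    by case: (lit_sat a l1) (lit_sat a l2) (lit_sat a l3)
      (v == l1.1) (v == l2.1) (v == l3.1) => [] [] [] [] [] [].
  by exists (r (k l1) (k l2) (k l3)); apply: rP => //; apply/implyP=> /andP[].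
Qed.

End Gadget.

(** * Arbitrary clauses and relations *)

Section Clauses.

Variable S : seq logrel.
Hypothesis has_clause2 :
  forall (V : finType) (l l' : V * bool), expressible S (clause2 l l').
Hypothesis has_clause3 : forall (V : finType) (l1 l2 l3 : V * bool),
  uniq [:: l1.1; l2.1; l3.1] ->
  expressible S [set a | [|| lit_sat a l1, lit_sat a l2 | lit_sat a l3]].

(** A long clause is split by a fresh [z] into [l1] or [l2] or [z], and not [z] or [c]; the second
    part is one literal shorter. *)
Lemma clause_expressible (V : finType) (c : seq (V * bool)) : c != [::] ->
  uniq [seq l.1 | l <- c] -> expressible S [set a : cube V | has (lit_sat a) c].
Proof.
have [n] := ubnP (size c); elim: n V c => // n IH V [|l1 [|l2 [|l3 c]]] // sz _ U.
- suff -> : [set a : cube V | has (lit_sat a) [:: l1]] = clause2 l1 l1 by [].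
  by apply/setP=> a; rewrite !inE /= orbF orbb.
- suff -> : [set a : cube V | has (lit_sat a) [:: l1; l2]] = clause2 l1 l2 by [].
  by apply/setP=> a; rewrite !inE /= orbF.
move: (l3 :: c) sz U => {l3}c sz U.
pose z : V + unit := inr tt.
pose inl_lit (l : V * bool) : (V + unit) * bool := (inl l.1, l.2).
have lit_inl (a : cube V) w l : lit_sat (join a w) (inl_lit l) = lit_sat a l.
  by rewrite /lit_sat /= ffunE.
have [U1 Uc] : uniq [:: l1.1; l2.1] /\ uniq [seq l.1 | l <- c].
  by move: U; rewrite /= !inE negb_or -!andbA => /and4P[-> _ _ ->].
have Ul : forall v, (v == l1.1) || (v == l2.1) -> v \notin [seq l.1 | l <- c].
  by move: U => /= /and3P[]; rewrite inE negb_or => /andP[_ n1] n2 _ v /orP[] /eqP->.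
pose B : {set cube (V + unit)%type} :=
  [set a | [|| lit_sat a (inl_lit l1), lit_sat a (inl_lit l2) | lit_sat a (z, true)]] :&:
  [set a | has (lit_sat a) ((z, false) :: map inl_lit c)].
have BE (a : cube V) b : (join a [ffun => b] \in B) =
    [|| lit_sat a l1, lit_sat a l2 | b] && (~~ b || has (lit_sat a) c).
  rewrite !inE !lit_inl /= has_map /lit_sat /= !ffunE eqb_id eqbF_neg.
  congr (_ && (_ || _)); rewrite ?ffunE //.
  by apply: eq_has => l; exact: lit_inl.
apply: (@expressible_elim _ _ B).
- move=> a; rewrite inE; apply/idP/existsP => [H|[b]].
    exists (has (lit_sat a) c); rewrite BE; move: H => /=.
    by case: (lit_sat a l1); case: (lit_sat a l2); case: (has _ c).
  by rewrite BE /=; case: b; case: (lit_sat a l1); case: (lit_sat a l2); case: (has _ c).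
- move=> a v; rewrite !inE => /= H H'.
  (* [z] copies the value of whichever side the flip leaves unchanged: that of [c], or the negation
     of [l1] or [l2]. *)
  have [v12|v12] := boolP ((v == l1.1) || (v == l2.1)).
    have E : has (lit_sat (flips a [:: v])) c = has (lit_sat a) c.
      apply: eq_in_has => l lc; rewrite lit_sat_flips.
      case: eqP => [vl|_]; last by rewrite addbF.
      by have := Ul _ v12; rewrite vl map_f.
    exists (has (lit_sat a) c); rewrite !BE E; move: H H'; rewrite E.
    by case: (has _ c); rewrite ?orbT //= !orbF => -> ->.
  move: v12; rewrite negb_or => /andP[/negbTE n1 /negbTE n2].
  exists (~~ (lit_sat a l1 || lit_sat a l2)); rewrite !BE; move: H H'.
  rewrite !lit_sat_flips n1 n2 !addbF.
  by case: (lit_sat a l1); case: (lit_sat a l2) => //= -> ->.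
- apply: expressibleI; last apply: IH => //.
  + apply: has_clause3; rewrite /= !inE (inj_eq inl_inj).
    by move: U1; rewrite /= inE andbT => /negbTE->.
  + by move: sz; rewrite /= size_map !ltnS; apply: leq_trans.
  + rewrite /= -map_comp; apply/andP; split; first by apply/mapP=> -[].
    by rewrite (map_comp inl fst) map_inj_uniq //; exact: inl_inj.
Qed.

(** Each non-member [s] is excluded by the full clause falsified by [s] alone; positive arity makes
    that clause nonempty. *)
Lemma relation_expressible (R : logrel) : expressible S (tuples R).
Proof.
suff -> : tuples R = \bigcap_(s | s \notin tuples R)
    [set a | has (lit_sat a) [seq (v, ~~ s v) | v <- enum 'I_(arity R)]].
  apply: expressible_bigcap => s _; apply: clause_expressible.
    have : size (enum 'I_(arity R)) != 0.
      by rewrite size_enum_ord -lt0n /arity; case: (R) => Q /= /andP[].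
    by case: (enum _).
  by rewrite -map_comp map_id enum_uniq.
apply/setP=> a; apply/idP/bigcapP=> [aR s sR|H].
  rewrite inE has_map; apply/hasP.
  have /existsP[v av] : [exists v, a v != s v].
    apply: contraR sR; rewrite negb_exists => /forallP E.
    suff <- : a = s by [].
    by apply/ffunP=> v; apply/eqP; have := E v; rewrite negbK.
  by exists v; rewrite ?mem_enum // /lit_sat /=; case: (a v) (s v) av => [] [].
apply/negPn/negP=> /H; rewrite inE has_map => /hasP[v _].
by rewrite /= /lit_sat /=; case: (a v).
Qed.

End Clauses.

(** * Numbering the auxiliary variables, and conclusion *)

Lemma expressible_faithfully (S : seq logrel) (R : logrel) :
  expressible S (tuples R) -> faithfully_expressible S R.
Proof.
case=> W [phi [Sphi [H1 H2 H3]]].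
pose r (x : 'I_(arity R) + W) : 'I_(arity R) + 'I_#|W| :=
  match x with inl i => inl i | inr w => inr (enum_rank w) end.
pose to (w : cube 'I_#|W|) : cube W := pull enum_rank w.
pose from (w : cube W) : cube 'I_#|W| := pull enum_val w.
have toK : cancel to from.
  by move=> w; apply/ffunP=> i; rewrite !ffunE enum_valK.
have fromK : cancel from to.
  by move=> w; apply/ffunP=> i; rewrite !ffunE enum_rankK.
have E (a : cube 'I_(arity R)) w :
    formula_sat (rename r phi) (join a w) = formula_sat phi (join a (to w)).
  by rewrite rename_sat; congr (formula_sat phi _); apply/ffunP=> -[x|x]; rewrite !ffunE.
exists #|W|, (rename r phi); split; first by rewrite rename_over.
- move=> a; rewrite H1; split=> -[w]; rewrite ?inE => Hw.
    by exists (from w); rewrite E fromK.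
  by exists (to w); rewrite inE -E.
- move=> a /H2 C w w'; rewrite !inE !E => Hw Hw'.
  have := C (to w) (to w'); rewrite !inE => /(_ Hw Hw').
  rewrite -{2}(toK w) -{2}(toK w'); apply: connect_homo => x y /and3P[].
  rewrite !inE => Hx Hy /hdist1P[v Ev]; apply/and3P.
  split; rewrite ?inE ?E ?fromK //; apply/hdist1P; exists (enum_rank v).
  apply/ffunP=> i; rewrite Ev flips1E ffunE flips1E ffunE.
  by congr (_ (+) _); rewrite -{2}(enum_valK i) (inj_eq enum_rank_inj).
- move=> a b aR bR /(H3 a b aR bR)[w]; rewrite !inE => Hw Hw'.
  by exists (from w); rewrite !E fromK.
Qed.

Theorem theorem2p7 (S : seq logrel) (hS : ~ tight S) (R : logrel) :
  faithfully_expressible S R.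
Proof.
have ex (P : logrel -> Prop) : ~ {in S, forall R, P R} -> exists2 R, R \in S & ~ P R.
  by move=> N; apply: NNPP => N'; apply: N => Q QS; apply: NNPP => NQ; apply: N'; exists Q.
have [R1 R1S N1] : exists2 R, R \in S & ~ componentwise_bijunctive R.
  by apply: ex => H; apply: hS; constructor 1.
have [R2 R2S /NNPP N2] : exists2 R, R \in S & ~ or_free R.
  by apply: ex => H; apply: hS; constructor 2.
have [R3 R3S /NNPP N3] : exists2 R, R \in S & ~ nand_free R.
  by apply: ex => H; apply: hS; constructor 3.
have or_ex := expressible_fixing R2S N2; have nand_ex := expressible_fixing R3S N3.
have c2_ex := expressible_clause2 or_ex nand_ex.
have hull_ex := expressible_hull2 or_ex nand_ex.
have [A NA] : exists A, ~ isometric (tuples R1 :&: hull2 A).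
  apply: NNPP => N; apply: N1 => a aR1; apply: bijunctive_component aR1 => A.
  by apply: NNPP => NA; apply: N; exists A.
have [u [x [g [Uxg szg Wg gX]]]] := detour NA.
have path_ex : expressible S (path_set u x g).
  rewrite -(path_setI Uxg Wg gX); apply: expressibleI => //.
  by apply: expressibleI => //; exact: expressible_tuples.
(* The detour has at least two inner flips, so its first and last ones [p] and [q] are different. *)
case: g szg Uxg Wg gX path_ex => [|p g] //; case/lastP: g => [|mid q] //.
move=> _ Uxg _ _ path_ex.
apply/expressible_faithfully/relation_expressible => //.
exact: clause3_expressible (latch_expressible c2_ex path_ex Uxg erefl).
Qed.
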